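(* Let $\mathbf{k}$ be a field, $d\ge3$, and $\Gamma$ a $(d-1)$-dimensional simplicial complex on $[n]$ with maximal shifts $M_i=M_i(S/I_\Gamma)$. If $M_1\ge d-1$ (equivalently, $Q_{d-3}=d-2$ for the upper skips $Q_i$), then $f_{d-1}(\Gamma)\le\frac{1}{(n-d)!}\prod_{i=1}^{n-d}M_i$.
   Context: A simplicial complex on $[n]$ is a family of subsets closed under subsets containing all singletons; $f_i$ counts faces of size $i+1$. For $S=\mathbf{k}[x_1,\dots,x_n]$ and Stanley–Reisner ideal $I_\Gamma$, $M_i=\max\{j:\beta_{i,j}(S/I_\Gamma)\ne0\}=\max\{|W|:W\subseteq[n],\ \tilde H_{|W|-i-1}(\Gamma[W];\mathbf{k})\ne0\}$. The $M_1<\dots<M_{n-d}$ lie in $\{2,\dots,n\}$ and the remaining $d$ elements of $[n]$ are the upper skips $Q_0=1<Q_1<\dots<Q_{d-1}$. *)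

(* Defs.v *)
From mathcomp Require Import all_boot all_order all_algebra.
Set Implicit Arguments. Unset Strict Implicit. Unset Printing Implicit Defensive.
Import GRing.Theory Num.Theory.
Local Open Scope ring_scope.

Definition is_simplicial_complex (n : nat) (G : {set {set 'I_n}}) : Prop :=
  (forall F H : {set 'I_n}, F \in G -> H \subset F -> H \in G) /\
  (forall x : 'I_n, [set x] \in G).

(* number of faces of size s, i.e. f_{s-1} *)
Definition fcount (n : nat) (G : {set {set 'I_n}}) (s : nat) : nat :=
  #|[set F in G | #|F| == s]|.

Definition induced (n : nat) (G : {set {set 'I_n}}) (W : {set 'I_n}) :
  {set {set 'I_n}} := [set F in G | F \subset W].

(* sign of the facet B of A (A = B + {x}): (-1)^{#{y in A | y < x}} *)
Definition bsign (k : fieldType) (n : nat) (A B : {set 'I_n}) : k :=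
  (-1) ^+ #|[set y in A | [exists x in A :\: B, (y < x)%N]]|.

(* Simplicial boundary map from the faces of size s to those of size s-1
   (reduced chain complex, with the empty face in degree -1), as a matrix
   indexed by all subsets of 'I_n; rows = source faces. *)
Definition bdry (k : fieldType) (n : nat) (G : {set {set 'I_n}}) (s : nat) :
  'M[k]_(#|{set 'I_n}|) :=
  \matrix_(i, j)
    (let A := (enum_val i : {set 'I_n}) in let B := (enum_val j : {set 'I_n}) in
     if [&& A \in G, #|A| == s, B \subset A & #|A| == #|B|.+1]
     then bsign k A B else 0).

(* rhdim k G s = dim_k \tilde H_{s-1}(G; k)  (reduced homology in degree s-1) *)
Definition rhdim (k : fieldType) (n : nat) (G : {set {set 'I_n}}) (s : nat) : nat :=
  (fcount G s - \rank (bdry k G s) - \rank (bdry k G s.+1))%N.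

(* maximal shift M_i = max{|W| : \tilde H_{|W|-i-1}(G[W]; k) <> 0}
   (Hochster's formula); degree |W|-i-1 >= -1 forces i <= |W|. *)
Definition maxshift (k : fieldType) (n : nat) (G : {set {set 'I_n}}) (i : nat) : nat :=
  \max_(W : {set 'I_n} | (i <= #|W|)%N && (rhdim k (induced G W) (#|W| - i) != 0%N))
    #|W|.

(* Main.v *)
(* The maximal shifts M_i increase strictly for i <= n - d
   (a homology class of Gamma[W] that is invisible in all larger induced
   subcomplexes would force a face of more than d vertices), so M_1 >= d - 1
   leaves only two unknown upper skips p < q, and n! / ((d-2)! p q) <= prod M_i.
   By Hochster, the homology of faces of size d - 1 vanishes on every p-set and
   that of faces of size d on every q-set. With r(U) the rank of the boundary
   map on the (d-1)-faces in U, this gives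
     f_{d-2}(U) - f_{d-1}(U) <= r(U)              for |U| = p,
     f_{d-1}(W) <= f_{d-2}(W) - r(W)              for |W| = q.
   A basis of the simplicial matroid on W contracted by the faces of Gamma
   restricts to independent sets on the subsets of W; hence the corank
   C(|U|-1, d-2) - r(U), averaged over U and divided by C(|U|, d-1), does not
   increase with |U|. Averaging the two inequalities and eliminating f_{d-2}
   and r yields f_{d-1} <= n! / ((n-d)! (d-2)! p q). *)
Require Import Defs.
From mathcomp Require Import all_boot all_order all_algebra.
From mathcomp Require Import ring zify.
Import GRing.Theory Num.Theory.
Local Open Scope ring_scope.

(** * Boundary, contraction and cone operators *)

Section Chains.
Set Implicit Arguments.
Unset Strict Implicit.
Context {k : fieldType} {n : nat}.
Implicit Types (A B F W U : {set 'I_n}) (X Y G : {set {set 'I_n}}) (x y v : 'I_n).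
Local Notation N := #|{set 'I_n}|.
Implicit Types z c : 'rV[k]_N.

Definition coeff z A : k := z 0 (enum_rank A).
Definition chain (phi : {set 'I_n} -> k) : 'rV[k]_N := \row_j phi (enum_val j).

Lemma coeff_chain phi A : coeff (chain phi) A = phi A.
Proof. by rewrite /coeff mxE enum_rankK. Qed.

Lemma chainP z c : (forall A, coeff z A = coeff c A) -> z = c.
Proof.
by move=> zc; apply/rowP=> j; have := zc (enum_val j); rewrite /coeff enum_valK.
Qed.

Lemma coeffD z c A : coeff (z + c) A = coeff z A + coeff c A.
Proof. by rewrite /coeff mxE. Qed.
Lemma coeffN z A : coeff (- z) A = - coeff z A.
Proof. by rewrite /coeff mxE. Qed.
Lemma coeff0 A : coeff 0 A = 0.
Proof. by rewrite /coeff mxE. Qed.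
Lemma coeff_sum (I : finType) (P : pred I) (g : I -> 'rV[k]_N) A :
  coeff (\sum_(i | P i) g i) A = \sum_(i | P i) coeff (g i) A.
Proof. by rewrite /coeff summxE. Qed.

Definition sgn x B : k := (-1) ^+ #|[set y in B | (y < x)%N]|.

Lemma sgnU1 x y B : x \notin B -> sgn y (x |: B) = (-1) ^+ (x < y)%N * sgn y B.
Proof.
move=> xB; rewrite /sgn -exprD; congr (_ ^+ _).
have -> : [set y0 in x |: B | (y0 < y)%N] =
  [set y0 in [set x] | (y0 < y)%N] :|: [set y0 in B | (y0 < y)%N].
  by apply/setP=> u; rewrite !inE andb_orl.
rewrite cardsU [X in (_ - X)%N](_ : _ = 0%N); last first.
  by apply: eq_card0 => u; rewrite !inE; case: eqP => // ->; rewrite (negPf xB) !andbF.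
rewrite subn0; congr (_ + _)%N.
case: (boolP (x < y)%N) => xy /=.
  by rewrite -(cards1 x); apply: eq_card => u; rewrite !inE; case: eqP => // ->.
by apply: eq_card0 => u; rewrite !inE; case: eqP => // ->; rewrite (negPf xy).
Qed.

Lemma sgnU1x x B : sgn x (x |: B) = sgn x B.
Proof.
rewrite /sgn; congr (_ ^+ #|pred_of_set _|); apply/setP=> u; rewrite !inE.
by case: eqP => // ->; rewrite ltnn !andbF.
Qed.

Lemma sgn_sqr x B : sgn x B * sgn x B = 1.
Proof. by rewrite /sgn -expr2 sqrr_sign. Qed.

(** Interior product with the dual basis vector of [x] in the exterior algebra; [cone v] is exterior
    multiplication by the basis vector of [v]. The sign lemmas below are the usual anticommutation
    relations between the two. *)
Definition contr x z : 'rV[k]_N :=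
  chain (fun B => if x \in B then 0 else sgn x B * coeff z (x |: B)).
Definition cone v z : 'rV[k]_N :=
  chain (fun A => if v \in A then sgn v A * coeff z (A :\ v) else 0).

Lemma contr_sum x (I : finType) (P : pred I) (g : I -> 'rV[k]_N) :
  contr x (\sum_(i | P i) g i) = \sum_(i | P i) contr x (g i).
Proof.
apply: chainP => A; rewrite coeff_chain !coeff_sum.
case: ifP => xA; first by rewrite big1 // => i _; rewrite coeff_chain xA.
by rewrite mulr_sumr; apply: eq_bigr => i _; rewrite coeff_chain xA.
Qed.

Lemma cone_sum v (I : finType) (P : pred I) (g : I -> 'rV[k]_N) :
  cone v (\sum_(i | P i) g i) = \sum_(i | P i) cone v (g i).
Proof.
apply: chainP => A; rewrite coeff_chain !coeff_sum.
case: ifP => xA; last by rewrite big1 // => i _; rewrite coeff_chain xA.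
by rewrite mulr_sumr; apply: eq_bigr => i _; rewrite coeff_chain xA.
Qed.

Lemma contr_anticomm x y z : contr x (contr y z) = - contr y (contr x z).
Proof.
apply: chainP => B; rewrite coeffN !coeff_chain !inE.
case: (eqVneq x y) => [-> | xy]; first by rewrite !mulr0 if_same oppr0.
rewrite /=.
case xB: (x \in B); case yB: (y \in B); rewrite ?mulr0 ?oppr0 //=.
rewrite [y |: (x |: B)]setUCA !sgnU1 ?xB ?yB // !mulrA -mulNr.
congr (_ * _); case: (ltngtP x y) => xy' /=; rewrite ?expr0 ?expr1; try ring.
by case/eqP: xy; apply: val_inj.
Qed.

Lemma contr_sqr x z : contr x (contr x z) = 0.
Proof.
by apply: chainP => B; rewrite coeff0 !coeff_chain !inE eqxx /= mulr0 if_same.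
Qed.

Lemma contr_coneE v z : contr v (cone v z) = z - cone v (contr v z).
Proof.
apply: chainP => B; rewrite coeffD coeffN !coeff_chain !inE eqxx /=.
case vB: (v \in B) => /=.
  by rewrite setD1K // -[in sgn v B](setD1K vB) sgnU1x mulrA sgn_sqr mul1r subrr.
by rewrite setU1K ?vB // sgnU1x mulrA sgn_sqr mul1r subr0.
Qed.

Lemma contr_cone x v z : x != v -> contr x (cone v z) = - cone v (contr x z).
Proof.
move=> xv; apply: chainP => B; rewrite coeffN !coeff_chain !inE xv (eq_sym v).
rewrite (negPf xv) /=; case vB: (v \in B); case xB: (x \in B); rewrite ?mulr0 ?oppr0 //=.
have -> : (x |: B) :\ v = x |: (B :\ v).
  by apply/setP=> u; rewrite !inE; case: (eqVneq u x) => //= ->; rewrite xv.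
rewrite !mulrA -mulNr; congr (_ * _).
rewrite -[in sgn x B](setD1K vB) -[in sgn v (x |: B)](setD1K vB) setUCA.
rewrite -[in sgn v B](setD1K vB) !sgnU1x !sgnU1 ?inE ?xB ?andbF ?eqxx //.
case: (ltngtP x v) => xv' /=; rewrite ?expr0 ?expr1; try ring.
by case/eqP: xv; apply: val_inj.
Qed.

(** Boundary of the full simplex on all vertices. The boundary of any subcomplex is a coordinate
    projection followed by this one matrix, so the chain identities need only be proved once. *)
Definition bd : 'M[k]_N := \matrix_(i, j)
  (let A := (enum_val i : {set 'I_n}) in let B := (enum_val j : {set 'I_n}) in
   if (B \subset A) && (#|A| == #|B|.+1) then bsign k A B else 0).

Lemma bsignU1 x B : x \notin B -> bsign k (x |: B) B = sgn x B.
Proof.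
move=> xB; rewrite -sgnU1x /bsign /sgn; congr (_ ^+ #|pred_of_set _|).
apply/setP=> y; rewrite !inE; congr (_ && _).
apply/existsP/idP => [[u]|yx]; last by exists x; rewrite !inE eqxx xB.
by rewrite !inE; case: eqP => [-> /andP[]|_ /=] //; case: (u \in B).
Qed.

Lemma mul_bd z : z *m bd = \sum_x contr x z.
Proof.
apply: chainP => B; rewrite coeff_sum {1}/coeff mxE.
rewrite (reindex_onto enum_rank enum_val) /=; last by move=> i _; rewrite enum_valK.
under eq_bigl do rewrite enum_rankK eqxx.
rewrite (bigID (fun A => (B \subset A) && (#|A| == #|B|.+1))) /= addrC big1 ?add0r; last first.
  by move=> A /negPf nA; rewrite mxE !enum_rankK /= nA mulr0.
rewrite [RHS](bigID (fun x => x \in B)) /= [X in _ = X + _]big1 ?add0r; last first.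
  by move=> x xB; rewrite coeff_chain xB.
have hP A : (B \subset A) && (#|A| == #|B|.+1) =
    (A \in [set x |: B | x in [set x | x \notin B]]).
  apply/andP/imsetP => [[BA /eqP cA]|[x]]; last first.
    by rewrite inE => xB ->; rewrite subsetUr cardsU1 xB.
  have /eqP/cards1P[x AB] : #|A :\: B| = 1%N.
    by rewrite cardsD (setIidPr BA) cA subSnn.
  have /setDP[xA xB] : x \in A :\: B by rewrite AB set11.
  exists x; rewrite ?inE //; apply/eqP; rewrite eq_sym eqEcard subUset sub1set xA BA /=.
  by rewrite cardsU1 xB cA.
rewrite (eq_bigl _ _ hP) big_imset /=; last first.
  move=> x y; rewrite !inE => xB yB /setP/(_ x); rewrite !inE eqxx /= (negPf xB) orbF.
  by move/esym/eqP.
apply: eq_big => [x|x]; rewrite inE // => xB.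
by rewrite coeff_chain (negPf xB) mxE !enum_rankK /= subsetUr cardsU1 xB eqxx bsignU1 // mulrC.
Qed.

End Chains.

(** * Supports, ranks and exactness *)

Section Exactness.
Set Implicit Arguments.
Unset Strict Implicit.
Context {k : fieldType} {n : nat}.
Implicit Types (A B F W U : {set 'I_n}) (X Y G : {set {set 'I_n}}) (x y v : 'I_n).
Local Notation N := #|{set 'I_n}|.
Implicit Types z c : 'rV[k]_N.
Local Notation bd := (@bd k n).

(* Pairing [(x, y)] with [(y, x)] makes the cancellation valid in characteristic 2. *)
Lemma sum_antisym (V : zmodType) (g : 'I_n -> 'I_n -> V) :
  (forall x, g x x = 0) -> (forall x y, g x y = - g y x) ->
  \sum_x \sum_y g x y = 0.
Proof.
move=> gd ga.
have -> : \sum_x \sum_y g x y =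
    \sum_(x : 'I_n) \sum_(y : 'I_n | (y < x)%N) g x y +
    \sum_(x : 'I_n) \sum_(y : 'I_n | (x < y)%N) g x y.
  rewrite -big_split; apply: eq_bigr => x _ /=.
  rewrite (bigID (fun y : 'I_n => (y < x)%N)) /=; congr (_ + _).
  rewrite (bigD1 x) ?ltnn //= gd add0r; apply: eq_bigl => y.
  by rewrite -leqNgt ltn_neqAle andbC eq_sym.
rewrite [X in _ + X](exchange_big_dep predT) //= -big_split big1 //= => x _.
by rewrite -big_split big1 //= => y _; rewrite ga addNr.
Qed.

Lemma mul_bd_bd z : z *m bd *m bd = 0.
Proof.
rewrite !mul_bd; under eq_bigr do rewrite contr_sum.
apply: sum_antisym => [x|x y]; [exact: contr_sqr | exact: contr_anticomm].
Qed.

Lemma bd_sqr : bd *m bd = 0.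
Proof. by apply/row_matrixP => i; rewrite row_mul rowE mul_bd_bd row0. Qed.

Lemma contr_bd v z : contr v z *m bd = - contr v (z *m bd).
Proof.
rewrite !mul_bd contr_sum -sumrN; apply: eq_bigr => x _; exact: contr_anticomm.
Qed.

(** Of the contractions that sum to the boundary, the one by [v] yields [z - cone v (contr v z)] and
    all others anticommute with [cone v]. This is the contracting homotopy of a cone. *)
Lemma cone_bd v z : cone v z *m bd = z - cone v (z *m bd).
Proof.
rewrite !mul_bd cone_sum (bigD1 v) //= [X in _ - X](bigD1 v) //= contr_coneE.
rewrite (eq_bigr _ (fun x xv => contr_cone z xv)) sumrN; by rewrite opprD addrA.
Qed.

Definition supp z X := forall A, A \notin X -> coeff z A = 0.

Lemma supp_contr v z X Y : supp z X ->
  (forall B, v \notin B -> v |: B \in X -> B \in Y) -> supp (contr v z) Y.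
Proof.
move=> zX XY B BY; rewrite coeff_chain; case: ifPn => // vB.
by rewrite zX ?mulr0 //; apply: contra BY; apply: XY.
Qed.

Lemma supp_cone v z X Y : supp z X ->
  (forall A, v \in A -> A :\ v \in X -> A \in Y) -> supp (cone v z) Y.
Proof.
move=> zX XY B BY; rewrite coeff_chain; case: ifPn => // vB.
by rewrite zX ?mulr0 //; apply: contra BY; apply: XY.
Qed.

Lemma supp_bd z X Y : supp z X ->
  (forall x B, x \notin B -> x |: B \in X -> B \in Y) -> supp (z *m bd) Y.
Proof.
move=> zX XY B BY; rewrite mul_bd coeff_sum big1 // => x _.
by apply: (supp_contr zX _ BY) => C; apply: XY.
Qed.

Lemma suppD z c X : supp z X -> supp c X -> supp (z + c) X.
Proof. by move=> zX cX A AX; rewrite coeffD zX // cX // addr0. Qed.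

Lemma suppN z X : supp z X -> supp (- z) X.
Proof. by move=> zX A AX; rewrite coeffN zX // oppr0. Qed.

Lemma supp_sub z X Y : X \subset Y -> supp z X -> supp z Y.
Proof. by move=> /subsetP XY zX A AY; apply: zX; apply: contra AY; apply: XY. Qed.

Lemma contr_avoid v z X : supp z X -> (forall A, A \in X -> v \notin A) ->
  contr v z = 0.
Proof.
move=> zX Xv; apply: chainP => B; rewrite coeff0 coeff_chain; case: ifPn => // vB.
by rewrite zX ?mulr0 //; apply/negP=> /Xv; rewrite !inE eqxx.
Qed.

Lemma contr_coneK v z X : supp z X -> (forall A, A \in X -> v \notin A) ->
  contr v (cone v z) = z.
Proof.
move=> zX Xv; rewrite contr_coneE (@contr_avoid v z X) //.
rewrite [cone v 0](_ : _ = 0) ?subr0 //.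
by apply: chainP => A; rewrite coeff_chain !coeff0 mulr0 if_same.
Qed.

Lemma supp0 X : supp 0 X.
Proof. by move=> A _; rewrite coeff0. Qed.

Definition proj X : 'M[k]_N := \matrix_(i, j) ((i == j) && (enum_val i \in X))%:R.

Lemma coeff_proj X z A : coeff (z *m proj X) A = if A \in X then coeff z A else 0.
Proof.
rewrite /coeff mxE (bigD1 (enum_rank A)) //= big1 ?addr0.
  by rewrite mxE eqxx enum_rankK /=; case: ifP => _; rewrite ?mulr1 ?mulr0.
by move=> i iA; rewrite mxE (negPf iA) mulr0.
Qed.

Lemma proj_id X z : supp z X -> z *m proj X = z.
Proof.
by move=> zX; apply: chainP => A; rewrite coeff_proj; case: ifPn => // /zX ->.
Qed.

Lemma sub_projP X z : reflect (supp z X) (z <= proj X)%MS.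
Proof.
apply: (iffP idP) => [/submxP[y ->] A AX|zX]; first by rewrite coeff_proj (negPf AX).
by rewrite -(proj_id zX) submxMl.
Qed.

Lemma projI X Y : proj X *m proj Y = proj (X :&: Y).
Proof.
apply/row_matrixP => i; rewrite row_mul !rowE; apply: chainP => A.
by rewrite !coeff_proj inE andbC; case: (A \in X); case: (A \in Y).
Qed.

Lemma projU_sub X Y : (proj (X :|: Y) <= proj X + proj Y)%MS.
Proof.
apply/row_subP => i; rewrite rowE; set e := delta_mx _ _.
have -> : e *m proj (X :|: Y) = e *m proj X + e *m proj (Y :\: X).
  apply: chainP => A; rewrite coeffD !coeff_proj !inE.
  by case: (A \in X); case: (A \in Y); rewrite ?addr0 ?add0r.
apply: addmx_sub_adds; first exact: submxMl.
have -> : proj (Y :\: X) = proj (Y :\: X) *m proj Y.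
  by rewrite projI (setIidPl (subsetDl _ _)).
by rewrite mulmxA submxMl.
Qed.

Lemma proj_sub X Y : X \subset Y -> (proj X <= proj Y)%MS.
Proof. by move=> /setIidPl XY; rewrite -XY -projI submxMl. Qed.

Lemma rank_proj_le X : (\rank (proj X) <= #|X|)%N.
Proof.
have: (proj X <= \sum_(A in X) (delta_mx (enum_rank A) (enum_rank A) : 'M[k]_N))%MS.
  apply/row_subP=> i; case iX: (enum_val i \in X); last first.
    rewrite [row i _](_ : _ = 0) ?sub0mx //; apply/rowP=> j.
    by rewrite !mxE iX andbF.
  apply: (submx_trans _ (sumsmx_sup (enum_val i) iX (submx_refl _))).
  rewrite enum_valK.
  have -> : row i (proj X) = row i (delta_mx i i).
    by apply/rowP => j; rewrite !mxE iX eqxx andbT eq_sym.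
  by rewrite row_sub.
move/mxrankS/leq_trans; apply.
apply: (leq_trans (mxrank_sum_leqif _).1) => /=.
rewrite -[#|X|]sum1_card; apply: leq_sum => A _; by rewrite mxrank_delta.
Qed.

(** The upper bound, applied to [X] and to its complement, forces equality because the two
    projections together span the whole space. *)
Lemma rank_proj X : \rank (proj X) = #|X|.
Proof.
apply/eqP; rewrite eqn_leq rank_proj_le /=.
have := leq_trans (mxrankS (projU_sub X (~: X))) (mxrank_adds_leqif _ _).1.
rewrite setUCr [proj setT](_ : _ = 1%:M) ?mxrank1; last first.
  by apply/matrixP=> i j; rewrite !mxE inE andbT.
move=> le; rewrite -(leq_add2r #|~: X|) cardsC (leq_trans le) // leq_add2l.
exact: rank_proj_le.
Qed.

(* Rank of [X] in the simplicial matroid. *)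
Definition srank X : nat := \rank (proj X *m bd).

Lemma srank_le X : (srank X <= #|X|)%N.
Proof. by rewrite -rank_proj mxrankM_maxl. Qed.

Lemma srankS X Y : X \subset Y -> (srank X <= srank Y)%N.
Proof. by move=> XY; apply/mxrankS/submxMr/proj_sub. Qed.

(** Modular law for the row spaces of the two images: the union maps into their sum, the
    intersection into their meet. *)
Lemma srank_submod X Y : (srank (X :|: Y) + srank (X :&: Y) <= srank X + srank Y)%N.
Proof.
rewrite /srank -(mxrank_sum_cap (proj X *m bd)); apply: leq_add.
  by apply: mxrankS; rewrite -addsmxMr submxMr // projU_sub.
apply: mxrankS; rewrite sub_capmx.
by rewrite !submxMr // proj_sub ?subsetIl ?subsetIr.
Qed.

Definition faces G W s := [set F in G | (F \subset W) && (#|F| == s)].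

Lemma bdryE G s : bdry k G s = proj [set F in G | #|F| == s] *m bd.
Proof.
apply/matrixP=> i j; rewrite !mxE (bigD1 i) //= big1 => [|l li]; last first.
  by rewrite mxE eq_sym (negPf li) mul0r.
rewrite addr0 !mxE eqxx inE /=.
by case: (enum_val i \in G); case: (#|enum_val i| == s); rewrite /= ?mul1r ?mul0r.
Qed.

Definition downclosed G := forall F H : {set 'I_n}, F \in G -> H \subset F -> H \in G.

Lemma supp_bd_faces z G W s : downclosed G -> supp z (faces G W s.+1) ->
  supp (z *m bd) (faces G W s).
Proof.
move=> dG zs; apply: (supp_bd zs) => x B xB.
rewrite !inE subUset cardsU1 xB eqSS => /and3P[BG /andP[_ ->] ->].
by rewrite (dG _ _ BG) ?subsetUr.
Qed.

(** Vanishing of reduced homology of the induced complex in degree [s - 1]: the index counts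
    vertices of faces, and every cycle gets an explicit filling. *)
Definition exact_at G W s := forall z, supp z (faces G W s) -> z *m bd = 0 ->
  exists2 c, supp c (faces G W s.+1) & z = c *m bd.

Lemma srank_faces_cycles G W s : downclosed G ->
  (proj (faces G W s.+1) *m bd <= proj (faces G W s) :&: kermx bd)%MS.
Proof.
move=> dG; rewrite sub_capmx; apply/andP; split; last first.
  by apply/sub_kermxP; rewrite -mulmxA bd_sqr mulmx0.
apply/row_subP=> i; rewrite row_mul; apply/sub_projP/supp_bd_faces => //.
by apply/sub_projP/row_sub.
Qed.

Lemma rank_cycles X : (\rank (proj X :&: kermx bd) + srank X = #|X|)%N.
Proof. by rewrite addnC mxrank_mul_ker rank_proj. Qed.

Lemma srank_faces_leq G W s : downclosed G ->
  (srank (faces G W s.+1) + srank (faces G W s) <= #|faces G W s|)%N.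
Proof.
by move=> dG; rewrite -rank_cycles leq_add2r mxrankS // srank_faces_cycles.
Qed.

Lemma exact_atP G W s : downclosed G ->
  reflect (exact_at G W s)
    (#|faces G W s| == srank (faces G W s) + srank (faces G W s.+1))%N.
Proof.
move=> dG; rewrite -rank_cycles addnC eqn_add2l eq_sym.
rewrite (mxrank_leqif_sup (srank_faces_cycles W s dG)).2.
apply: (iffP idP) => [le z zs zbd|ex].
  have /submxP[y zE] : (z <= proj (faces G W s.+1) *m bd)%MS.
    apply: submx_trans le; rewrite sub_capmx; apply/andP; split; first exact/sub_projP.
    exact/sub_kermxP.
  exists (y *m proj (faces G W s.+1)); last by rewrite zE mulmxA.
  by apply/sub_projP; rewrite submxMl.
apply/row_subP=> i; have := row_sub i (proj (faces G W s) :&: kermx bd)%MS.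
rewrite sub_capmx => /andP[/sub_projP zs /sub_kermxP zbd].
have [c /sub_projP cs ->] := ex _ zs zbd; exact: submxMr.
Qed.

Lemma rhdim_faces G W s : rhdim k (induced G W) s =
  (#|faces G W s| - srank (faces G W s) - srank (faces G W s.+1))%N.
Proof.
rewrite /rhdim /fcount !bdryE /srank.
have fE t : [set F in induced G W | #|F| == t] = faces G W t.
  by apply/setP=> F; rewrite !inE andbA.
by rewrite !fE.
Qed.

(** The truncated subtractions in [rhdim] lose nothing, since the two ranks never add up to more
    than the number of faces. *)
Lemma rhdim_eq0P G W s : downclosed G ->
  reflect (exact_at G W s) (rhdim k (induced G W) s == 0%N).
Proof.
move=> dG; suff -> : (rhdim k (induced G W) s == 0%N) =
    (#|faces G W s| == srank (faces G W s) + srank (faces G W s.+1))%N.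
  exact: exact_atP.
rewrite rhdim_faces -subnDA subn_eq0 eqn_leq addnC.
by rewrite srank_faces_leq ?andbT.
Qed.

End Exactness.

(** * Links and strict growth of the maximal shifts *)

Section Link.
Set Implicit Arguments.
Unset Strict Implicit.
Variables (k : fieldType) (n : nat).
Implicit Types (A B F W U V : {set 'I_n}) (X Y G : {set {set 'I_n}}) (x y v : 'I_n).
Local Notation exact_at := (@exact_at k n).
Local Notation bd := (@bd k n).

Definition link G v := [set F : {set 'I_n} | (v \notin F) && (v |: F \in G)].

Lemma downclosed_link G v : downclosed G -> downclosed (link G v).
Proof.
move=> dG F H; rewrite !inE => /andP[vF FG] HF; apply/andP; split.
  by apply: contra vF; apply: (subsetP HF).
by apply: dG FG _; apply: setUS.
Qed.

Lemma facesS G W W' s : W \subset W' -> faces G W s \subset faces G W' s.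
Proof.
move=> WW; apply/subsetP=> F; rewrite !inE => /and3P[-> FW ->].
by rewrite (subset_trans FW WW).
Qed.

Lemma faces_link_sub G W v s : downclosed G -> faces (link G v) W s \subset faces G W s.
Proof.
move=> dG; apply/subsetP=> F; rewrite !inE => /andP[/andP[_ FG] ->].
by rewrite andbT (dG _ _ FG) ?subsetUr.
Qed.

Lemma faces_linkU1 G W v s B : v \notin B -> v |: B \in faces G (v |: W) s.+1 ->
  B \in faces (link G v) W s.
Proof.
move=> vB; rewrite !inE subUset cardsU1 vB eqSS => /and3P[-> /andP[_ BW] ->].
rewrite /= andbT; apply/subsetP => u uB; have := subsetP BW u uB.
by rewrite !inE; case: eqP => // uv; rewrite -uv uB in vB.
Qed.

Lemma faces_U1 G W v s B : v \notin B -> B \in faces G (v |: W) s -> B \in faces G W s.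
Proof.
move=> vB; rewrite !inE => /and3P[-> BW ->].
rewrite /= andbT; apply/subsetP => u uB; have := subsetP BW u uB.
by rewrite !inE; case: eqP => // uv; rewrite -uv uB in vB.
Qed.

Lemma faces_avoid G W s v : v \notin W -> forall A, A \in faces G W s -> v \notin A.
Proof.
move=> vW A; rewrite !inE => /and3P[_ AW _]; apply: contra vW; exact: (subsetP AW).
Qed.

(* Exactness of [H(lk v) -> H(W) -> H(W + v)]. *)
Lemma exact_at_link_left G W v s : downclosed G -> v \notin W ->
  exact_at (link G v) W s -> exact_at G (v |: W) s -> exact_at G W s.
Proof.
move=> dG vW exl exW z zs zbd.
have [c cs zE] := exW z (supp_sub (facesS G s (subsetUr _ _)) zs) zbd.
(* The faces of [c] through [v] define a chain in the link; it is a cycle because [z] avoids [v]. *)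
have ys : supp (contr v c) (faces (link G v) W s).
  by apply: (supp_contr cs) => B; apply: faces_linkU1.
have [|e es eE] := exl _ ys.
  by rewrite contr_bd -zE (contr_avoid zs) ?oppr0 //; apply: faces_avoid.
have es' := supp_sub (faces_link_sub _ _ _ dG) es.
(* Adding this boundary cancels the part of [c] through [v]: what remains is [e] plus
   [contr v (cone v c)], the part of [c] avoiding [v]. *)
exists (c + cone v e *m bd); last by rewrite mulmxDl mul_bd_bd addr0.
rewrite cone_bd -eE addrCA; apply: suppD => //.
pose Y := [set A | A :\ v \in faces G (v |: W) s.+1].
rewrite -contr_coneE; apply: supp_contr (supp_cone (Y := Y) cs _) _.
  by move=> A vA AX; rewrite in_set.
by move=> B vB; rewrite in_set setU1K //; apply: faces_U1.
Qed.

(* Exactness of [H(W + v) -> H(lk v) -> H(W)]. *)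
Lemma exact_at_link G W v s : downclosed G -> v \notin W ->
  exact_at G W s -> exact_at G (v |: W) s.+1 -> exact_at (link G v) W s.
Proof.
move=> dG vW exW exvW y ys ybd.
have ys' := supp_sub (faces_link_sub _ _ _ dG) ys.
have [e es yE] := exW y ys' ybd.
have cone0 : cone v (0 : 'rV[k]_#|{set 'I_n}|) = 0.
  by apply: chainP => A; rewrite coeff_chain !coeff0 mulr0 if_same.
(* Both [cone v y] and [e] have boundary [y], so their difference is a cycle on [v |: W].
   Contracting it by [v] recovers [y], hence contracting a filling [g] fills [y] in the link, up to
   sign. *)
have [||g gs gE] := exvW (cone v y - e).
- apply: suppD; last exact/suppN/(supp_sub _ es)/facesS/subsetUr.
  apply: (supp_cone ys) => A vA; rewrite !inE vA => /and3P[/andP[_ AG] AW /eqP cA].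
  rewrite setD1K // in AG; rewrite AG (cardsD1 v) vA cA add1n eqxx andbT /=.
  by rewrite -(setD1K vA) setUS.
- by rewrite mulmxBl cone_bd ybd cone0 subr0 -yE subrr.
exists (- contr v g).
  by apply: suppN; apply: (supp_contr gs) => B; apply: faces_linkU1.
rewrite mulNmx contr_bd opprK -gE; apply: chainP => A.
have := congr1 (fun z => coeff z A) (contr_coneK ys (faces_avoid vW)).
have := congr1 (fun z => coeff z A) (contr_avoid es (faces_avoid vW)).
rewrite !coeff_chain coeff0; case: ifP => // _ e0 <-.
by rewrite coeffD coeffN mulrDr mulrN e0 subr0 coeff_chain.
Qed.

Lemma exact_at_no_faces G W s : faces G W s = set0 -> exact_at G W s.
Proof.
move=> f0 z zs _; exists 0; first exact: supp0.
by rewrite mul0mx; apply: chainP => A; rewrite zs ?coeff0 // f0 inE.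
Qed.

(* The face in fact contains [V]: pass to the links of the vertices of [V] one
   at a time; the class on [W] survives in each of them. *)
Lemma face_of_homology G W V s : downclosed G -> [disjoint W & V] ->
  ~ exact_at G W s ->
  (forall A m, A \subset V -> #|A| = m.+1 -> exact_at G (W :|: A) (s + m)%N) ->
  exists2 F, F \in G & #|F| = (s + #|V|)%N.
Proof.
have [m] := ubnP #|V|; elim: m G V => // m IH G V leV dG dWV nex exA.
have [->|[v vV]] := set_0Vmem V.
  case: (set_0Vmem (faces G W s)) => [/exact_at_no_faces //|[F]].
  by rewrite !inE => /and3P[FG _ /eqP cF]; exists F; rewrite // cards0 addn0.
have vW : v \notin W by move: dWV; rewrite disjoint_sym => /pred0P/(_ v) /=; rewrite vV /= => ->.
have cV : #|V| = #|V :\ v|.+1 by rewrite (cardsD1 v) vV.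
have [|||||F FG cF] := IH (link G v) (V :\ v).
- by rewrite -ltnS -cV.
- exact: downclosed_link.
- by apply: disjointWr dWV; rewrite subD1set.
(* The class dies on [v |: W]; were the link exact on [W], it would already die on [W]. *)
- move=> exl; apply: nex; apply: exact_at_link_left exl _ => //.
  by rewrite setUC -[s]addn0; apply: exA; rewrite ?sub1set ?cards1.
(* Exactness of the link on [W :|: A] comes from exactness of [G] there and, one degree higher, on
   the set enlarged by [v]. *)
- move=> A l; rewrite subsetD1 => /andP[AV vA] cA; apply: exact_at_link => //.
  + by rewrite inE negb_or vW.
  + exact: exA.
  rewrite -addnS setUCA; apply: exA; first by rewrite subUset sub1set vV.
  by rewrite cardsU1 vA cA.
exists (v |: F); first by move: FG; rewrite inE => /andP[].
by move: FG; rewrite inE => /andP[vF _]; rewrite cardsU1 vF cF cV addnCA.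
Qed.

(** An empty maximum is 0, so positivity guarantees a witness. *)
Lemma maxshift_attained G i : (0 < maxshift k G i)%N ->
  exists2 W : {set 'I_n}, (i <= #|W|)%N && (rhdim k (induced G W) (#|W| - i) != 0%N) &
    #|W| = maxshift k G i.
Proof.
pose P := [set W : {set 'I_n} | (i <= #|W|)%N && (rhdim k (induced G W) (#|W| - i) != 0%N)].
have -> : maxshift k G i = (\max_(W in P) #|W|)%N by apply: eq_bigl => W; rewrite inE.
case: (set_0Vmem P) => [-> | [W0 PW0] _]; first by rewrite big_set0.
have P0 : (0 < #|P|)%N by apply/card_gt0P; exists W0.
have [W PW ->] := eq_bigmax_cond (fun W : {set 'I_n} => #|W|) P0.
by exists W; rewrite inE in PW.
Qed.

Lemma maxshift_exact G W i : downclosed G -> (i <= #|W|)%N ->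
  (maxshift k G i < #|W|)%N -> exact_at G W (#|W| - i)%N.
Proof.
move=> dG iW lt; apply/rhdim_eq0P => //; apply: contraTT lt => nz.
rewrite -leqNgt; apply: (@leq_bigmax_cond _ _ (fun W : {set 'I_n} => #|W|)).
by rewrite iW.
Qed.

(** Let [W] attain the [i]-th shift. If the next shift were at most [#|W|], the relevant homology
    would vanish on every proper superset of [W], and [face_of_homology] with the complement of [W]
    would give a face with [n - i > d] vertices. *)
Lemma maxshift_lt G d i : downclosed G -> (forall F, F \in G -> (#|F| <= d)%N) ->
  (i < n - d)%N -> (0 < maxshift k G i)%N -> (maxshift k G i < maxshift k G i.+1)%N.
Proof.
move=> dG Gd id /maxshift_attained[W /andP[iW hW] <-].
rewrite ltnNge; apply/negP => le.
have cW := cardsC W; rewrite card_ord in cW.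
have [|||F FG cF] := @face_of_homology G W (~: W) (#|W| - i)%N dG.
- by rewrite -subsets_disjoint.
- by move/rhdim_eq0P => /(_ dG); rewrite (negPf hW).
- move=> A m AW cA.
  have cWA : #|W :|: A| = (#|W| + m.+1)%N.
    by rewrite -cA cardsU (_ : W :&: A = set0) ?cards0 ?subn0 //;
       apply/eqP; rewrite setI_eq0 disjoint_sym disjoints_subset.
  have -> : (#|W| - i + m = #|W :|: A| - i.+1)%N by lia.
  by apply: maxshift_exact => //; rewrite cWA; lia.
have := Gd _ FG; rewrite cF; lia.
Qed.

End Link.

(** * Double counting *)

Section Counting.
Set Implicit Arguments.
Unset Strict Implicit.
Variables (T : finType).
Implicit Types (F W U V : {set T}) (X : {set {set T}}).
Local Open Scope nat_scope.


(** Complements in [W] of the counted sets are the subsets of [W :\: F] of size [#|W| - p]. This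
    lower index keeps the formula valid, with value 0, when [p < #|F|]. *)
Lemma card_between F W p : F \subset W -> p <= #|W| ->
  #|[set U : {set T} | [&& F \subset U, U \subset W & #|U| == p]]| =
    'C(#|W| - #|F|, #|W| - p).
Proof.
move=> FW pW.
have <- : #|W :\: F| = #|W| - #|F| by rewrite cardsD (setIidPr FW).
have WDK V : V \subset W -> W :\: (W :\: V) = V.
  by move=> VW; rewrite setDDr setDv set0U; apply/setIidPr.
rewrite -cards_draws -(@card_in_imset _ _ (fun V => W :\: V)); last first.
  move=> V1 V2; rewrite !inE => /and3P[_ V1W _] /and3P[_ V2W _] e.
  by rewrite -(WDK V1) // e WDK.
apply: eq_card => A; rewrite inE subsetD; apply/imsetP/andP => [[U]|[/andP[AW dAF] /eqP cA]].
  rewrite inE => /and3P[FU UW /eqP cU] ->.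
  rewrite subsetDl cardsD (setIidPr UW) cU eqxx; split=> //=.
  by rewrite -setI_eq0 setIDAC setD_eq0 (subset_trans (subsetIr _ _)).
exists (W :\: A); last by rewrite WDK.
by rewrite inE subsetD FW disjoint_sym dAF subsetDl cardsD (setIidPr AW) cA subKn /=.
Qed.

Lemma sum_card_between X W p t : p <= #|W| ->
  (forall F, F \in X -> F \subset W /\ #|F| = t) ->
  \sum_(U : {set T} | (U \subset W) && (#|U| == p)) #|[set F in X | F \subset U]| =
    #|X| * 'C(#|W| - t, #|W| - p).
Proof.
move=> pW XW.
under eq_bigr do rewrite -sum1_card.
rewrite (exchange_big_dep (fun F => F \in X)) /=; last first.
  by move=> U F _; rewrite inE => /andP[].
rewrite -sum_nat_const; apply: eq_bigr => F FX; have [FW <-] := XW F FX.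
rewrite -card_between // -sum1_card; apply: eq_bigl => U.
by rewrite !inE FX /= andbC.
Qed.

End Counting.

(** Evaluates the total of the full-simplex ranks over all [p]-sets. Multiplying by
    [(n - p)! * (p - 1 - s)!] turns each binomial coefficient into factorials. *)
Lemma bin_id (n s p : nat) : (s < p)%N -> (p <= n)%N ->
  ('C(n, p) * 'C(p.-1, s) * p * s`! * (n - s.+1)`! = n`! * 'C(n - s.+1, n - p))%N.
Proof.
move=> sp pn.
have e1 := bin_fact pn.
have e2 : ('C(p.-1, s) * (s`! * (p.-1 - s)`!) = p.-1`!)%N by apply: bin_fact; lia.
have e3 : ('C(n - s.+1, n - p) * ((n - p)`! * (p.-1 - s)`!) = (n - s.+1)`!)%N.
  have -> : (p.-1 - s = n - s.+1 - (n - p))%N by lia.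
  by apply: bin_fact; lia.
have e4 : (p`! = p * p.-1`!)%N by case: p sp {pn e1 e2 e3}.
have n0 : (0 < (n - p)`! * (p.-1 - s)`!)%N by rewrite muln_gt0 !fact_gt0.
apply/eqP; rewrite -(eqn_pmul2r n0); apply/eqP.
by rewrite -e1 e4 -e2 -e3; ring.
Qed.

(* [f], [g] count the facets and the codimension-one faces; [Sp], [Sq] sum the
   ranks of the latter over the vertex sets of sizes [p] and [q]. *)
Lemma facet_bound_arith (n s p q f g Sp Sq : nat) :
  (s < p)%N -> (p < q)%N -> (q <= n)%N ->
  (g * 'C(n - s.+1, n - p) <= Sp + f * 'C(n - s.+2, n - p))%N ->
  (f * 'C(n - s.+2, n - q) + Sq <= g * 'C(n - s.+1, n - q))%N ->
  (Sp * 'C(n - p, n - q) + 'C(n, q) * 'C(q.-1, s) * 'C(q - s.+1, q - p) <=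
     'C(n, q) * 'C(q, p) * 'C(p.-1, s) + Sq * 'C(q - s.+1, q - p))%N ->
  (f * (p * q * s`! * (n - s.+2)`!) <= n`!)%N.
Proof.
move=> sp pq qn I1 I2 I3.
have pn : (p <= n)%N by lia.
have bp := bin_id sp pn.
have bq := bin_id (ltn_trans sp pq) qn.
have cp : ((n - s.+1) * 'C(n - s.+2, n - p) = 'C(n - s.+1, n - p) * (p - s.+1))%N.
  have -> : (n - s.+2 = (n - s.+1).-1)%N by lia.
  rewrite mul_bin_down mulnC; congr (_ * _)%N; lia.
have cq : ((n - s.+1) * 'C(n - s.+2, n - q) = 'C(n - s.+1, n - q) * (q - s.+1))%N.
  have -> : (n - s.+2 = (n - s.+1).-1)%N by lia.
  rewrite mul_bin_down mulnC; congr (_ * _)%N; lia.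
have npq : ('C(n, q) * 'C(q, p) = 'C(n, p) * 'C(n - p, n - q))%N.
  have h1 := bin_fact qn. have h2 := bin_fact (ltnW pq). have h3 := bin_fact pn.
  have h4 : ('C(n - p, n - q) * ((n - q)`! * (q - p)`!) = (n - p)`!)%N.
    have -> : (q - p = n - p - (n - q))%N by lia.
    by apply: bin_fact; lia.
  have z : (0 < p`! * (q - p)`! * (n - q)`!)%N by rewrite !muln_gt0 !fact_gt0.
  apply/eqP; rewrite -(eqn_pmul2r z); apply/eqP.
  transitivity (n`!); [rewrite -h1 -h2|rewrite -h3 -h4]; ring.
(* Both products are the multinomial coefficient that splits [n - s - 1] into parts [p - s - 1],
   [q - p] and [n - q]. *)
have abgd : ('C(n - s.+1, n - p) * 'C(n - p, n - q) = 'C(n - s.+1, n - q) * 'C(q - s.+1, q - p))%N.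
  have h1 : ('C(n - s.+1, n - p) * ((n - p)`! * (p - s.+1)`!) = (n - s.+1)`!)%N.
    have -> : (p - s.+1 = n - s.+1 - (n - p))%N by lia.
    by apply: bin_fact; lia.
  have h2 : ('C(n - s.+1, n - q) * ((n - q)`! * (q - s.+1)`!) = (n - s.+1)`!)%N.
    have -> : (q - s.+1 = n - s.+1 - (n - q))%N by lia.
    by apply: bin_fact; lia.
  have h3 : ('C(q - s.+1, q - p) * ((q - p)`! * (p - s.+1)`!) = (q - s.+1)`!)%N.
    have -> : (p - s.+1 = q - s.+1 - (q - p))%N by lia.
    by apply: bin_fact; lia.
  have h4 : ('C(n - p, n - q) * ((n - q)`! * (q - p)`!) = (n - p)`!)%N.
    have -> : (q - p = n - p - (n - q))%N by lia.
    by apply: bin_fact; lia.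
  have z : (0 < (q - p)`! * (n - q)`! * (p - s.+1)`!)%N by rewrite !muln_gt0 !fact_gt0.
  apply/eqP; rewrite -(eqn_pmul2r z); apply/eqP.
  transitivity ((n - s.+1)`!); [rewrite -h1 -h4|rewrite -h2 -h3]; ring.
have L0 : (0 < n - s.+1)%N by lia.
have LE : ((n - s.+1)`! = (n - s.+1) * (n - s.+2)`!)%N.
  by have -> : (n - s.+1 = (n - s.+2).+1)%N by lia.
have a0 : (0 < 'C(n - s.+1, n - p))%N by rewrite bin_gt0; lia.
have b0 : (0 < 'C(n - s.+1, n - q))%N by rewrite bin_gt0; lia.
have c0 : (0 < 'C(n - p, n - q))%N by rewrite bin_gt0; lia.
have d0 : (0 < 'C(q - s.+1, q - p))%N by rewrite bin_gt0; lia.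
have Fs0 := fact_gt0 s. have Fm0 := fact_gt0 (n - s.+2).
have qpE : (q - s.+1 = (p - s.+1) + (q - p))%N by lia.
have qE : (q = p + (q - p))%N by lia.
have p0 : (0 < p)%N by lia.
have t0 : (0 < q - p)%N by lia.
move: I1 I2 I3 bp bq cp cq npq abgd LE L0 a0 b0 c0 d0 Fs0 Fm0 qpE qE p0 t0.
set al := 'C(n - s.+1, n - p); set be := 'C(n - s.+1, n - q).
set ga := 'C(n - p, n - q); set de := 'C(q - s.+1, q - p).
set u := 'C(n - s.+2, n - p); set w := 'C(n - s.+2, n - q).
set L := (n - s.+1)%N; set Fs := s`!; set Fm := (n - s.+2)`!; set FL := L`!.
set Fn := n`!; set nq := 'C(n, q); set np := 'C(n, p); set qp := 'C(q, p).
set ps := 'C(p.-1, s); set qs := 'C(q.-1, s).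
set a := (p - s.+1)%N; set b := (q - s.+1)%N; set t := (q - p)%N.
clearbody al be ga de u w L Fs Fm FL Fn nq np qp ps qs a b t.
move=> I1 I2 I3 bp bq cp cq npq K LE L0 a0 b0 c0 d0 Fs0 Fm0 bE qE p0 t0.
(* The first two inequalities are scaled so that, by [K], the terms in [g] agree; adding the third
   then cancels [g], [Sp] and [Sq], and leaves [f] with coefficient [b - a = t]. *)
have J1 : (L * g * (al * ga) <= L * Sp * ga + f * (al * a) * ga)%N.
  by rewrite -cp; have := leq_mul (leqnn (L * ga)) I1; lia.
have J2 : (f * (be * b) * de + L * Sq * de <= L * g * (be * de))%N.
  by rewrite -cq; have := leq_mul (leqnn (L * de)) I2; lia.
have J3 : (L * Sp * ga + L * (nq * qs) * de <= L * (np * ga) * ps + L * Sq * de)%N.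
  by rewrite -npq; have := leq_mul (leqnn L) I3; lia.
have J4 : (f * (be * de) * t + L * (nq * qs) * de <= L * (np * ga) * ps)%N.
  by move: J1 J2; rewrite K bE; move: K J3; nia.
(* After this scaling [bin_id] makes the two remaining terms multiples of [n!] by [q] and by [p];
   their difference again contains the factor [t], which cancels. *)
have J5 : (f * (be * de) * t * (p * q * Fs * FL) + L * p * Fn * (be * de) <=
           L * q * Fn * (be * de))%N.
  have := leq_mul (leqnn (p * q * Fs * FL)) J4.
  have -> : (p * q * Fs * FL * (L * (np * ga) * ps) = L * q * Fn * (be * de))%N.
    by rewrite -K; transitivity (L * q * ga * (np * ps * p * Fs * FL))%N;
      [ring | rewrite bp; ring].
  have <- : (p * q * Fs * FL * (L * (nq * qs) * de) = L * p * Fn * (be * de))%N.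
    by transitivity (L * p * de * (nq * qs * q * Fs * FL))%N; [ring | rewrite bq; ring].
  by lia.
have J6 : (f * (p * q * Fs * Fm) * (L * t * (be * de)) <= Fn * (L * t * (be * de)))%N.
  have : (L * q * Fn * (be * de) = L * p * Fn * (be * de) + Fn * (L * t * (be * de)))%N.
    by rewrite {1}qE; ring.
  by move: J5; rewrite LE; lia.
by move: J6; rewrite leq_pmul2r // !muln_gt0 L0 t0 b0.
Qed.

(** * The simplicial matroid *)

Section SimplicialMatroid.
Set Implicit Arguments.
Unset Strict Implicit.
Variables (k : fieldType) (n : nat).
Implicit Types (A F W U V : {set 'I_n}) (B X Y Z G : {set {set 'I_n}}) (v : 'I_n).
Local Notation srank := (@srank k n).
Local Notation bd := (@bd k n).
Local Notation full := (faces [set: {set 'I_n}]).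
Local Open Scope nat_scope.

Lemma downclosed_full : downclosed [set: {set 'I_n}].
Proof. by move=> F H; rewrite !inE. Qed.

Lemma card_full W s : #|full W s| = 'C(#|W|, s).
Proof. by rewrite -cards_draws; apply: eq_card => F; rewrite !inE. Qed.

Lemma exact_full v W s : v \in W -> exact_at (k := k) setT W s.
Proof.
move=> vW z zs zbd; exists (cone v z); last first.
  rewrite cone_bd zbd [cone v 0](_ : _ = 0%R) ?subr0 //.
  by apply: chainP => A; rewrite coeff_chain !coeff0 mulr0 if_same.
apply: (supp_cone zs) => A vA; rewrite !inE /= => /andP[AW /eqP cA].
by rewrite (cardsD1 v) vA cA eqxx andbT -(setD1K vA) subUset sub1set vW.
Qed.

Lemma srank_faces0 G W : srank (faces G W 0) = 0.
Proof.
apply/eqP; rewrite /srank mxrank_eq0; apply/eqP/row_matrixP => i.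
rewrite row_mul row0; have /sub_projP := row_sub i (proj (k := k) (faces G W 0)).
move=> /(@supp_bd _ _ _ _ set0) h; apply: chainP => A; rewrite coeff0 h ?inE //.
by move=> x B xB; rewrite !inE cardsU1 xB andbA andbF.
Qed.

(** The simplex is a cone, hence exact, so consecutive ranks add up to ['C(#|W|, s.+1)]; Pascal's
    rule gives the induction. *)
Lemma srank_full W s : 0 < #|W| -> srank (full W s.+1) = 'C(#|W|.-1, s).
Proof.
case/card_gt0P => v vW; elim: s => [|s IH].
  have /exact_atP := @exact_full _ _ 0 vW; move/(_ downclosed_full)/eqP.
  by rewrite srank_faces0 card_full !bin0.
have /exact_atP := @exact_full _ _ s.+1 vW; move/(_ downclosed_full)/eqP.
rewrite IH card_full.
have -> : #|W| = #|W|.-1.+1 by rewrite prednK //; apply/card_gt0P; exists v.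
by rewrite binS /= addnC => /addnI.
Qed.

(** The only candidate face is [W] itself, and its boundary is nonzero. This replaces exactness when
    a skip takes its least possible value. *)
Lemma faces_top G W s : #|W| = s.+1 -> srank (faces G W s.+1) = #|faces G W s.+1|.
Proof.
move=> cW; have sub : faces G W s.+1 \subset [set W].
  apply/subsetP => F; rewrite !inE => /and3P[_ FW /eqP cF].
  by rewrite eqEcard FW cW cF /=.
have [->|[F FX]] := set_0Vmem (faces G W s.+1).
  by apply/eqP; rewrite cards0 -leqn0 (leq_trans (srank_le _)) ?cards0.
have FW : F = W by apply/set1P/(subsetP sub).
have f1 : srank [set W] = 1.
  have -> : [set W] = full W s.+1.
    apply/setP => A; rewrite !inE /=; apply/eqP/andP => [->|[AW /eqP cA]].
      by rewrite subxx cW.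
    by apply/eqP; rewrite eqEcard AW cW cA /=.
  by rewrite srank_full cW // binn.
have e : faces G W s.+1 = [set W].
  by apply/eqP; rewrite eqEsubset sub sub1set; rewrite FW in FX.
by rewrite e f1 cards1.
Qed.

Lemma srankU_le X B : srank (X :|: B) <= srank X + #|B|.
Proof.
have := @srank_submod k n X B; have := @srank_le k n B; lia.
Qed.

(** Elements of [Y] are added one at a time; submodularity keeps an element spanned by [Z] spanned
    by every larger set. *)
Lemma srankU_spanned Z Y : (forall A, A \in Y -> srank (A |: Z) <= srank Z) ->
  srank (Z :|: Y) <= srank Z.
Proof.
have [m] := ubnP #|Y|; elim: m Y => // m IH Y leY hY.
have [->|[A AY]] := set_0Vmem Y; first by rewrite setU0.
have h1 : srank (Z :|: (Y :\ A)) <= srank Z.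
  apply: IH; first by rewrite -ltnS; move: leY; rewrite (cardsD1 A) AY.
  by move=> C /setD1P[_ CY]; apply: hY.
have h2 := hY _ AY.
have := @srank_submod k n (Z :|: (Y :\ A)) (A |: Z).
have -> : (Z :|: (Y :\ A)) :|: (A |: Z) = Z :|: Y.
  by rewrite -[in RHS](setD1K AY); apply/setP => C;
    rewrite !inE; do !case: (_ \in _) || case: eqP => //=.
have := @srankS k n Z ((Z :|: (Y :\ A)) :&: (A |: Z)).
rewrite subsetI subsetUl subsetUr => /(_ isT).
have arith (x y a b z : nat) : a <= z -> b <= z -> z <= y -> x + y <= a + b -> x <= z by lia.
exact: arith h1 h2.
Qed.

(* A basis of [X] in the contraction by [Z]. *)
Lemma contraction_basis Z X : Z \subset X ->
  exists2 B : {set {set 'I_n}}, B \subset X & srank (Z :|: B) = srank Z + #|B| /\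
    srank X = srank (Z :|: B).
Proof.
move=> ZX; pose P (B : {set {set 'I_n}}) := (B \subset X) && (srank (Z :|: B) == srank Z + #|B|).
have P0 : P set0 by rewrite /P sub0set setU0 cards0 addn0 /=.
case: (arg_maxnP (fun B : {set {set 'I_n}} => #|B|) P0) => B /andP[BX /eqP rB] maxB.
exists B => //; split => //; apply/eqP; rewrite eqn_leq andbC srankS ?subUset ?ZX //=.
rewrite -[X in srank X <= _](setUidPr (_ : Z :|: B \subset X)) ?subUset ?ZX //.
(* An element of [X] outside the span could be added to [B], against its maximality. *)
apply: srankU_spanned => A AX; rewrite leqNgt; apply/negP => lt.
have AB : A \notin B.
  apply/negP => AB; move: lt; rewrite [A |: _](_ : _ = Z :|: B) ?ltnn //.
  by apply/setUidPr; rewrite sub1set inE AB orbT.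
have e : A |: (Z :|: B) = Z :|: (A |: B) by rewrite setUCA.
have PA : P (A |: B).
  rewrite /P subUset sub1set AX BX /= eqn_leq srankU_le cardsU1 AB -e /=.
  by rewrite add1n addnS -rB.
by have := maxB _ PA; rewrite cardsU1 AB add1n /= ltnn.
Qed.

(** Independence in a contraction passes to subsets and to contraction by a smaller set, by
    submodularity for [Z] and [Z' :|: B']. *)
Lemma srank_restrict Z B Z' B' : Z' \subset Z -> B' \subset B ->
  srank (Z :|: B) = srank Z + #|B| -> srank Z' + #|B'| <= srank (Z' :|: B').
Proof.
move=> ZZ BB rB.
have h1 : srank (Z :|: B) <= srank (Z :|: B') + #|B :\: B'|.
  apply: leq_trans (srankU_le _ _); apply: srankS.
  rewrite -setUA setUS //; apply/subsetP => F FB; rewrite !inE FB.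
  by case: (F \in B').
have h2 := cardsD B B'; rewrite (setIidPr BB) in h2.
have h3 := subset_leq_card BB.
have := @srank_submod k n Z (Z' :|: B').
have -> : Z :|: (Z' :|: B') = Z :|: B' by rewrite setUA (setUidPl ZZ).
have := @srankS k n Z' (Z :&: (Z' :|: B')).
rewrite subsetI ZZ subsetUl => /(_ isT); lia.
Qed.

Lemma facesE G U W s : U \subset W -> faces G U s = [set F in faces G W s | F \subset U].
Proof.
move=> UW; apply/setP => F; rewrite !inE; case FU: (F \subset U); rewrite ?andbF //=.
by rewrite (subset_trans FU UW) andbT.
Qed.

(** The corank on [W] is the size of a contraction basis [B]. The members of [B] inside [U] bound
    the corank on [U] from below, and each member lies in ['C(#|W| - s.+1, #|W| - p)] of the sets
    [U]. *)
Lemma sum_srank_between G W s p : 0 < p <= #|W| ->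
  \sum_(U : {set 'I_n} | (U \subset W) && (#|U| == p)) srank (faces G U s.+1) +
    'C(#|W|.-1, s) * 'C(#|W| - s.+1, #|W| - p) <=
  'C(#|W|, p) * 'C(p.-1, s) + srank (faces G W s.+1) * 'C(#|W| - s.+1, #|W| - p).
Proof.
move=> /andP[p0 pW].
have sub : faces G W s.+1 \subset full W s.+1.
  by apply/subsetP => F; rewrite !inE => /andP[_ ->].
have [B BX [rB rX]] := contraction_basis sub.
have cB : 'C(#|W|.-1, s) = srank (faces G W s.+1) + #|B|.
  by rewrite -rB -rX srank_full //; apply: leq_trans pW.
rewrite cB mulnDl addnCA [X in _ <= X]addnC leq_add2l.
rewrite -(@sum_card_between _ B W p s.+1) //; last first.
  by move=> F /(subsetP BX); rewrite !inE /= => /andP[-> /eqP ->].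
rewrite -big_split /= -cards_draws -sum1_card big_distrl /=.
rewrite [X in _ <= X](eq_bigl (fun U : {set 'I_n} => (U \subset W) && (#|U| == p))); last first.
  by move=> U; rewrite inE.
apply: leq_sum => U /andP[UW /eqP cU]; rewrite mul1n.
have UG : faces G U s.+1 \subset faces G W s.+1 by apply: facesS.
have BU : [set F in B | F \subset U] \subset B by apply/subsetP => F; rewrite inE => /andP[].
apply: leq_trans (srank_restrict UG BU rB) _.
rewrite -cU -srank_full ?cU //; apply: srankS; rewrite subUset; apply/andP; split.
  by apply/subsetP => F; rewrite !inE => /andP[_ ->].
apply/subsetP => F; rewrite inE => /andP[/(subsetP BX)]; rewrite !inE /=.
by case/andP=> _ -> ->.
Qed.

(** Here [s] is [d - 2]. The alternatives [p = s.+1] and [q = s.+2] are the cases where no maximal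
    shift precedes the skip, so no vanishing is available. *)
Lemma facet_bound G s p q :
  downclosed G -> (forall F, F \in G -> #|F| <= s.+2) ->
  s < p -> p < q -> q <= n ->
  (forall U, #|U| = p -> @exact_at k n G U s.+1 \/ p = s.+1) ->
  (forall W, #|W| = q -> @exact_at k n G W s.+2 \/ q = s.+2) ->
  fcount G s.+2 * (p * q * s`! * (n - s.+2)`!) <= n`!.
Proof.
move=> dG Gd sp pq qn exp exq.
pose sum r := \sum_(U : {set 'I_n} | #|U| == r) srank (faces G U s.+1).
have cT : #|[set: 'I_n]| = n by rewrite cardsT card_ord.
have fE t : fcount G t = #|faces G setT t|.
  by apply: eq_card => F; rewrite !inE subsetT.
have sumE r t : r <= n ->
    \sum_(U : {set 'I_n} | #|U| == r) #|faces G U t| = #|faces G setT t| * 'C(n - t, n - r).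
  move=> rn; have := @sum_card_between _ (faces G setT t) setT r t.
  rewrite cT => <- //; last by move=> F; rewrite !inE => /and3P[_ -> /eqP].
  by apply: eq_big => [U|U _]; rewrite ?subsetT // -facesE ?subsetT.
have pn : p <= n by lia.
rewrite fE; apply: (@facet_bound_arith n s p q _ #|faces G setT s.+1| (sum p) (sum q)) => //.
- rewrite -!sumE // -big_split /=; apply: leq_sum => U /eqP cU.
  have [/(exact_atP _ _ dG)/eqP -> | ps] := exp U cU.
    by rewrite leq_add2l srank_le.
  by rewrite faces_top ?leq_addr // cU.
(* No face has [s.+3] vertices, so exactness makes the facets inside [W] independent. *)
- rewrite -!sumE // -big_split /=; apply: leq_sum => W /eqP cW.
  apply: leq_trans (@srank_faces_leq k n G W s.+1 dG); rewrite leq_add2r.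
  have [/(exact_atP _ _ dG)/eqP -> | qs] := exq W cW; last by rewrite faces_top // cW.
  rewrite -[X in _ <= X]addn0 leq_add2l (leq_trans (srank_le _)) // leqn0.
  rewrite cards_eq0; apply/eqP/setP => F; rewrite !inE.
  by apply/negP => /and3P[/Gd + _ /eqP cF]; rewrite cF ltnn.
(* Each [p]-set lies in ['C(n - p, n - q)] sets of size [q], so the claim splits into
   [sum_srank_between] for each [q]-set. *)
have -> : sum p * 'C(n - p, n - q) = \sum_(W : {set 'I_n} | #|W| == q)
    \sum_(U : {set 'I_n} | (U \subset W) && (#|U| == p)) srank (faces G U s.+1).
  rewrite (exchange_big_dep (fun U : {set 'I_n} => #|U| == p)) /=; last first.
    by move=> W U _ /andP[].
  rewrite big_distrl /=; apply: eq_bigr => U cU.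
  rewrite (eq_bigl (mem [set W : {set 'I_n} |
    [&& U \subset W, W \subset setT & #|W| == q]])); last first.
    by move=> W; rewrite !inE cU subsetT andbT andbC.
  by rewrite sum_nat_const card_between ?subsetT ?cT ?(eqP cU) // mulnC.
have cN r (c : nat) : 'C(n, r) * c = \sum_(W : {set 'I_n} | #|W| == r) c.
  rewrite -{1}cT -cards_draws -sum_nat_const; apply: eq_bigl => W.
  by rewrite !inE subsetT.
rewrite -!mulnA !cN -!big_split /= big_distrl -big_split /=.
apply: leq_sum => W /eqP cW; rewrite -cW; apply: sum_srank_between.
by rewrite cW; lia.
Qed.

End SimplicialMatroid.

(** * The product of the maximal shifts *)

Section Shifts.
Set Implicit Arguments.
Unset Strict Implicit.
Local Open Scope nat_scope.

(** For strictly increasing [M] with [M i >= t + i], the value [t + a + 1] is skipped by [M]. The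
    choice [a = 0] means that no index satisfies the bound. *)
Lemma last_index_le (M : nat -> nat) t c : exists a,
  [/\ a <= c, 0 < a -> M a <= t + a & forall i, a < i <= c -> t + i < M i].
Proof.
elim: c => [|c [a [ac Ma aM]]].
  by exists 0; split => // i; case: i.
have [le|lt] := leqP (M c.+1) (t + c.+1).
  by exists c.+1; split => // i /andP[ci ic]; lia.
exists a; split => // [|i /andP[ai]]; first exact: leqW.
by rewrite leq_eqVlt => /orP[/eqP -> //|ic]; apply: aM; rewrite ai.
Qed.

Lemma prodS_fact t m1 m2 : m1 <= m2 ->
  (t + m1)`! * \prod_(m1 <= i < m2) (t + i).+1 = (t + m2)`!.
Proof.
elim: m2 => [|m2 IH]; first by rewrite leqn0 => /eqP ->; rewrite big_geq ?muln1.
rewrite leq_eqVlt => /orP[/eqP ->|]; first by rewrite big_geq // muln1.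
by rewrite ltnS => le; rewrite big_nat_recr //= mulnA IH // addnS factS mulnC.
Qed.

(** On the three blocks of indices the lower bounds run through all of [s + 1, ..., s + 2 + c]
    except [s + a + 1] and [s + b + 2]; these two and [s!] complete the factorial. *)
Lemma fact_le_prod (M : nat -> nat) s a b c : a <= b -> b <= c ->
  (forall i, 0 < i <= c -> s + i <= M i) ->
  (forall i, a < i <= c -> s.+1 + i <= M i) ->
  (forall i, b < i <= c -> s.+2 + i <= M i) ->
  (s.+2 + c)`! <= (\prod_(1 <= i < c.+1) M i) * ((s + a).+1 * (s.+1 + b).+1 * s`!).
Proof.
move=> ab bc M0 M1 M2.
rewrite big_add1 /= (big_cat_nat (n := b)) //= (big_cat_nat (n := a)) //=.
have fS m i : (m.+1 + i)`! = (m + i).+1 * (m + i)`! by rewrite addSn factS.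
rewrite -(prodS_fact s.+2 bc) fS -(prodS_fact s.+1 ab) fS.
have := prodS_fact s (leq0n a); rewrite addn0 => <-.
have leS t m1 m2 : m2 <= c -> (forall i, m1 < i <= c -> t + i <= M i) ->
    \prod_(m1 <= i < m2) (t + i).+1 <= \prod_(m1 <= i < m2) M i.+1.
  move=> mc hM; rewrite big_nat_cond [X in _ <= X]big_nat_cond.
  apply: leq_prod => i /andP[/andP[mi im] _]; rewrite -addnS; apply: hM.
  by rewrite ltnS mi (leq_trans im).
have l1 := leS s 0 a (leq_trans ab bc) M0.
have l2 := leS s.+1 a b bc M1.
have l3 := leS s.+2 b c (leqnn c) M2.
have := leq_mul (leq_mul (leq_mul l1 l2) l3) (leqnn ((s + a).+1 * (s.+1 + b).+1 * s`!)).
apply: leq_trans; rewrite leq_eqVlt; apply/orP; left; apply/eqP; ring.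
Qed.

Lemma maxshift_ge (k : fieldType) n d (G : {set {set 'I_n}}) t i :
  downclosed G -> (forall F : {set 'I_n}, F \in G -> #|F| <= d) ->
  0 < t -> t.+1 <= maxshift k G 1 -> 0 < i <= n - d -> t + i <= maxshift k G i.
Proof.
move=> dG Gd t0 M1; elim: i => // -[|i] IH /= ic; first by rewrite addn1.
have {}IH := IH (ltnW ic); rewrite addnS; apply: leq_trans (maxshift_lt dG Gd ic _) => //.
by apply: leq_trans IH; rewrite addn_gt0 t0.
Qed.

End Shifts.

Theorem theorem2p5 (k : fieldType) (n d : nat) (G : {set {set 'I_n}}) :
  (3 <= d)%N ->
  is_simplicial_complex G ->
  (forall F, F \in G -> (#|F| <= d)%N) ->
  (exists F, F \in G /\ #|F| = d) ->
  (d - 1 <= maxshift k G 1)%N ->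
  ((fcount G d)%:R : rat) <=
    (\prod_(1 <= i < (n - d).+1) ((maxshift k G i)%:R : rat)) / ((n - d)`!)%:R.
Proof.
case: d => [|[|s]] // s0 [dG _] Gd [F0 [_ cF0]]; rewrite subn1 /= => M1.
have sn : (s.+2 <= n)%N by rewrite -cF0 -[X in (_ <= X)%N]card_ord max_card.
set c := (n - s.+2)%N; set M := maxshift k G.
(* The two unknown skips are [p = s + a + 1] and [q = s + b + 2]. *)
have [a [ac Ma aM]] := last_index_le M s c.
have [b [bc Mb bM]] := last_index_le M s.+1 c.
have ab : (a <= b)%N.
  rewrite leqNgt; apply/negP => ba; have := bM a; rewrite ba ac => /(_ isT).
  by have := Ma (leq_ltn_trans (leq0n _) ba); lia.
have bound : (fcount G s.+2 * ((s + a).+1 * (s.+1 + b).+1 * s`! * c`!) <= n`!)%N.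
  apply: (@facet_bound k) => //; try (rewrite /c in bc; lia).
  (* For [a > 0], a set of size [p] exceeds the [a]-th shift, so homology vanishes at
     [#|U| - a = s.+1]. *)
  - move=> U cU; case: (posnP a) => [->|a0]; [by right; rewrite addn0 | left].
    have -> : (s.+1 = #|U| - a)%N by rewrite cU; lia.
    by apply: maxshift_exact => //; rewrite cU; [lia | apply: leq_ltn_trans (Ma a0) _].
  - move=> W cW; case: (posnP b) => [->|b0]; [by right; rewrite addn0 | left].
    have -> : (s.+2 = #|W| - b)%N by rewrite cW; lia.
    by apply: maxshift_exact => //; rewrite cW; [lia | apply: leq_ltn_trans (Mb b0) _].
have nE : n = (s.+2 + c)%N by rewrite subnKC.
have := fact_le_prod ab bc (fun i => maxshift_ge dG Gd s0 M1) aM bM.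
rewrite -nE => /(leq_trans bound) {}bound.
rewrite ler_pdivlMr ?ltr0n ?fact_gt0 // -natr_prod -natrM ler_nat.
have z : (0 < (s + a).+1 * (s.+1 + b).+1 * s`!)%N by rewrite !muln_gt0 fact_gt0.
by rewrite -(leq_pmul2r z) (leq_trans _ bound) // mulnAC -!mulnA.
Qed.
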